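(* Let $R$ be a $\Delta U$ ring, i.e. $U(R)=1+\Delta(R)$. Then: (1) $U(R)+U(R)\subseteq \Delta(R)$, where $U(R)+U(R)=\{u+v : u,v\in U(R)\}$. (2) $R$ is a $UUC$ ring. (3) $(U(R)+U(R))\cap \mathrm{Id}(R)=\{0\}$.
   Context: Rings are associative with identity, not necessarily commutative. $U(R)$ is the group of units of $R$ and $\mathrm{Id}(R)$ the set of idempotents. $\Delta(R)=\{r\in R : r+U(R)\subseteq U(R)\}$, i.e. the set of $r$ such that $r+u$ is a unit for every unit $u$. A ring $R$ is called $\Delta U$ if $U(R)=1+\Delta(R)$. A ring $R$ is called $UUC$ if every unit is uniquely clean, that is, for every $u\in U(R)$ there is exactly one pair $(e,v)$ with $e\in \mathrm{Id}(R)$, $v\in U(R)$ and $u=e+v$. *)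

(* Defs.v *)
From mathcomp Require Import all_boot all_algebra.
From mathcomp Require Import boolp classical_sets.

Set Implicit Arguments.
Unset Strict Implicit.
Unset Printing Implicit Defensive.

Import GRing.Theory.
Local Open Scope classical_set_scope.
Local Open Scope ring_scope.

(* [pzRingType] carries no boolean unit predicate and, unlike [unitRingType],
   allows the zero ring, so units are defined here as the two-sided invertible
   elements; [units_unitRingE] compares this with [GRing.unit]. *)
Definition units (R : pzRingType) : set R :=
  [set u : R | exists v, u * v = 1 /\ v * u = 1].
Arguments units : clear implicits.

Definition idempotents (R : pzRingType) : set R := [set e : R | e * e = e].
Arguments idempotents : clear implicits.

Definition Delta (R : pzRingType) : set R :=
  [set r : R | [set r + u | u in units R] `<=` units R].
Arguments Delta : clear implicits.

Definition DeltaU (R : pzRingType) : Prop :=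
  units R = [set 1 + r | r in Delta R].

Definition uniquely_clean (R : pzRingType) (a : R) : Prop :=
  exists! p : R * R,
    [/\ idempotents R p.1, units R p.2 & a = p.1 + p.2].

Definition UUC (R : pzRingType) : Prop :=
  forall u : R, units R u -> uniquely_clean u.

Lemma units_unitRingE (R : unitRingType) : units R = [set` @GRing.unit R].
Proof.
apply/seteqP; split=> u /=.
  by move=> [v [uv vu]]; apply/unitrP; exists v.
by move=> /unitrP[v [vu uv]]; exists v.
Qed.

(* Main.v *)
(* For units [u] and [v], both [u] and [- v] lie in [1 + Delta R], so their
   difference [u + v] lies in the additive subgroup [Delta R].  An idempotent
   [e] of [Delta R] vanishes, since [1 - e] is then an idempotent unit, i.e. [1].
   Hence [u = e + v] with [u], [v] units forces [e = u - v] to be [0]. *)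
Require Import Defs.
From mathcomp Require Import all_boot all_algebra.
From mathcomp Require Import boolp classical_sets.

Set Implicit Arguments.
Unset Strict Implicit.
Unset Printing Implicit Defensive.

Import GRing.Theory.
Local Open Scope classical_set_scope.
Local Open Scope ring_scope.

Lemma units1 (R : pzRingType) : units R 1.
Proof. by exists 1; rewrite mulr1. Qed.

Lemma unitsN (R : pzRingType) (u : R) : units R u -> units R (- u).
Proof. by move=> [v [uv vu]]; exists (- v); rewrite !mulrNN. Qed.

(** Since [- r + u = - (r + (- u))], closure of the units under negation suffices. *)
Lemma DeltaN (R : pzRingType) (r : R) : Delta R r -> Delta R (- r).
Proof.
move=> Dr _ [u Uu <-]; rewrite -[u]opprK -opprD.
by apply/unitsN/Dr; exists (- u) => //; apply: unitsN.
Qed.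

Lemma DeltaD (R : pzRingType) (r s : R) :
  Delta R r -> Delta R s -> Delta R (r + s).
Proof.
move=> Dr Ds _ [u Uu <-]; rewrite -addrA; apply: Dr.
by exists (s + u) => //; apply: Ds; exists u.
Qed.

(** The inverse of [e] cancels one factor in [e * e = e]. *)
Lemma idempotent_units_eq1 (R : pzRingType) (e : R) :
  idempotents R e -> units R e -> e = 1.
Proof. by rewrite /idempotents /= => ee [v [ev _]]; rewrite -ev -{2}ee -mulrA ev mulr1. Qed.

Lemma idempotent_Delta_eq0 (R : pzRingType) (e : R) :
  idempotents R e -> Delta R e -> e = 0.
Proof.
rewrite /idempotents /= => ee De.
(* [1 - e] is the negative of [e + (- 1)], a unit because [e] is in [Delta R]. *)
have U1e : units R (1 - e).
  rewrite -opprB; apply/unitsN/De.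
  by exists (- 1) => //; apply/unitsN/units1.
have I1e : idempotents R (1 - e).
  by rewrite /idempotents /= mulrBr mulr1 mulrBl mul1r ee subrr subr0.
by rewrite -[e](subKr 1) (idempotent_units_eq1 I1e U1e) subrr.
Qed.

Lemma DeltaU_unitsD (R : pzRingType) (u v : R) :
  DeltaU R -> units R u -> units R v -> Delta R (u + v).
Proof.
move=> UE Uu /unitsN UNv; move: Uu UNv; rewrite UE => -[r Dr <-] [s Ds vE].
(* From [- v = 1 + s], the two ones cancel in [u - (- v)]. *)
have -> : 1 + r + v = r - s.
  by rewrite -[v]opprK -vE opprD addrACA subrr add0r.
by apply: DeltaD => //; apply: DeltaN.
Qed.

Theorem proposition2p2 (R : pzRingType) (hR : DeltaU R) :
  [/\ [set u + v | u in units R & v in units R] `<=` Delta R,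
      UUC R
    & [set u + v | u in units R & v in units R] `&` idempotents R = [set 0]].
Proof.
split.
- by move=> _ [u Uu [v Uv <-]]; apply: DeltaU_unitsD.
(* The decomposition [u = 0 + u] always exists; only uniqueness uses [hR]. *)
- move=> u Uu; exists (0, u); split.
    by split; rewrite /idempotents /= ?mulr0 ?add0r.
  move=> [e v] [/= Ie Uv uE].
  suff e0 : e = 0 by rewrite uE e0 add0r.
  apply: idempotent_Delta_eq0 => //.
  have -> : e = u - v by rewrite uE addrK.
  by apply: DeltaU_unitsD => //; apply: unitsN.
- apply/seteqP; split=> [_ [[u Uu [v Uv <-]] Ie]|_ ->] /=.
    by apply: idempotent_Delta_eq0 => //; apply: DeltaU_unitsD.
  split; last by rewrite /idempotents /= mulr0.
  (* [0 = 1 + (- 1)] is a sum of two units. *)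
  exists 1; first exact: units1.
  by exists (- 1); [exact/unitsN/units1 | exact: subrr].
Qed.
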